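(* Let $\{X_\alpha : \alpha\in A\}$ be a family of sequentially pracompact topological spaces. Then the product $X=\prod_{\alpha\in A}X_\alpha$ (with the Tychonoff product topology) is sequentially pracompact, and every $\Sigma$-product of the family $\{X_\alpha : \alpha\in A\}$ is sequentially pracompact.
   Context: No separation axioms are assumed. A topological space $X$ is sequentially pracompact if it contains a dense subset $D$ such that each sequence of points of $D$ has a subsequence converging to a point of $X$. Let $X=\prod_{\alpha\in A}X_\alpha$. A $\Sigma$-product of the family $\{X_\alpha\}$ is a subspace $Y\subset X$ (with the subspace topology) for which there exists a point $y=(y_\alpha)\in X$ such that $Y=\{x\in X : x_\alpha=y_\alpha \text{ for all but countably many } \alpha\in A\}$. *)

(* Defs.v *)
From mathcomp Require Import all_boot all_order.
From mathcomp Require Import all_classical all_reals topology sequences.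
Set Implicit Arguments.
Unset Strict Implicit.
Unset Printing Implicit Defensive.

Local Open Scope classical_set_scope.

Definition sequentially_pracompact (T : topologicalType) : Prop :=
  exists2 D : set T, dense D &
    forall u : nat -> T, (forall n, D (u n)) ->
      exists2 phi : nat -> nat, increasing_seq phi &
        exists l : T, u \o phi @ \oo --> l.

Definition is_sigma_product (A : Type) (X : A -> topologicalType)
    (Y : set (prod_topology X)) : Prop :=
  exists y : prod_topology X,
    Y = [set x | countable [set a | x a <> y a]].

(* Main.v *)
Require Import Defs.
From mathcomp Require Import all_boot all_order.
From mathcomp Require Import all_classical all_reals topology sequences.

(** Fix a point [y] of the product, let [D a] witness sequential pracompactness
    of [X a], and let [D] be the set of the points [x] that differ from [y] in
    finitely many coordinates and satisfy [x a \in D a `|` [set y a]] for all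
    [a].  The set [D] is dense in the product, hence in the Sigma-product
    around [y].  The supports of the terms of a sequence in [D] have a countable
    union [B]; a diagonal argument over [B] gives a subsequence converging in
    all the coordinates of [B], while all the other coordinates are constantly
    those of [y].  So the limit again lies in the Sigma-product around [y]. *)

Set Implicit Arguments.
Unset Strict Implicit.
Unset Printing Implicit Defensive.

Local Open Scope classical_set_scope.

Section subsequences.

Lemma increasing_seq_nat (f : nat -> nat) :
  (forall n, (f n < f n.+1)%N) -> increasing_seq f.
Proof. by move=> f_incr; apply/increasing_seqP => n; exact: f_incr. Qed.

Lemma increasing_seq_ltn (f : nat -> nat) m n :
  increasing_seq f -> (m < n)%N -> (f m < f n)%N.
Proof. by move=> /leqW_mono /(_ m n) <-. Qed.

Lemma increasing_seq_geid (f : nat -> nat) n : increasing_seq f -> (n <= f n)%N.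
Proof.
move=> f_incr; elim: n => // n /leq_ltn_trans; apply.
exact: increasing_seq_ltn.
Qed.

Lemma increasing_seq_comp (f g : nat -> nat) :
  increasing_seq f -> increasing_seq g -> increasing_seq (f \o g).
Proof. by move=> f_incr g_incr m n; rewrite f_incr; exact: g_incr. Qed.

Lemma increasing_seq_frequently (P : set nat) :
  (forall N, exists2 n, (N <= n)%N & P n) ->
  exists2 f : nat -> nat, increasing_seq f & forall n, P (f n).
Proof.
move=> /(_ _)/cid2-/all_sig2[g g_ge Pg].
(* Since [N <= g N], the map [g \o S] strictly exceeds its argument, so its iterates increase. *)
exists (fun n => iter n (g \o S) (g 0)).
  by apply: increasing_seq_nat => n /=; exact: g_ge.
by case=> [|n] /=; exact: Pg.
Qed.

(** Refine successively to get [F k], then take the diagonal [F n n]. The second hypothesis says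
    that [Q k] only looks at tails and is inherited by whatever is eventually drawn from [f] at
    indices that are no earlier. *)
Lemma diagonal_subsequence (Q : nat -> (nat -> nat) -> Prop) :
  (forall k f, increasing_seq f ->
    exists2 g : nat -> nat, increasing_seq g & Q k (f \o g)) ->
  (forall k f f' N, Q k f ->
    (forall n, (N <= n)%N -> exists2 i, (n <= i)%N & f' n = f i) -> Q k f') ->
  exists2 f : nat -> nat, increasing_seq f & forall k, Q k f.
Proof.
move=> Qsub Qtail.
(* Putting monotonicity inside the chosen property makes [h] total, so [F] can be defined by plain
   recursion and shown increasing afterwards. *)
have /choice[h hP] (kf : nat * (nat -> nat)) : exists g : nat -> nat,
    increasing_seq kf.2 -> increasing_seq g /\ Q kf.1 (kf.2 \o g).
  have [f_incr|] := pselect (increasing_seq kf.2); last by exists id.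
  by have [g ? ?] := Qsub kf.1 _ f_incr; exists g.
pose F := fix F k := if k is j.+1 then F j \o h (j, F j) else id.
have F_incr k : increasing_seq (F k).
  elim: k => [//|k IHk]; have [h_incr _] := hP (k, F k) IHk.
  exact: increasing_seq_comp.
have h_incr k : increasing_seq (h (k, F k)) by have [] := hP (k, F k) (F_incr k).
have FD k d n : exists2 i, (n <= i)%N & F (d + k)%N n = F k i.
  elim: d n => [|d IHd] n; first by exists n.
  have [i hi Fi] := IHd (h ((d + k)%N, F (d + k)%N) n).
  by exists i => //; apply: leq_trans hi; exact: increasing_seq_geid.
exists (fun n => F n n).
  apply: increasing_seq_nat => n /=; apply: increasing_seq_ltn => //.
  exact: increasing_seq_geid.
move=> k; have [_ QF] := hP (k, F k) (F_incr k).
(* [Q k] is secured at stage [k.+1], and from that index on the diagonal is drawn from [F k.+1]. *)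
apply: (Qtail k (F k.+1) _ k.+1 QF) => n kn.
by have [i ni Fi] := FD k.+1 (n - k.+1)%N n; exists i; rewrite // -Fi subnK.
Qed.

End subsequences.

Definition subseq_cvg (T : topologicalType) (D : set T) :=
  forall u : nat -> T, (forall n, D (u n)) ->
    exists2 f : nat -> nat, increasing_seq f & exists l : T, u \o f @ \oo --> l.

(** Either the sequence visits [D] infinitely often, or it is eventually constantly [y]. *)
Lemma subseq_cvgU1 (T : topologicalType) (D : set T) (y : T) :
  subseq_cvg D -> subseq_cvg (D `|` [set y]).
Proof.
move=> Dcvg u uDy.
have [/increasing_seq_frequently[f f_incr Df]|] :=
    pselect (forall N, exists2 n, (N <= n)%N & D (u n)).
  have [g g_incr [l ul]] := Dcvg (u \o f) Df.
  by exists (f \o g); [exact: increasing_seq_comp | exists l].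
move=> /existsNP[N Nu]; exists id => //; exists y => W /nbhs_singleton Wy.
exists N => // n /= Nn; case: (uDy n) => [Dn|-> //].
by exfalso; apply: Nu; exists n.
Qed.

Section product.
Variables (A : Type) (X : A -> topologicalType).
Implicit Types (x y z : prod_topology X).

Lemma cvg_prod_topology (F : set_system (prod_topology X)) x : Filter F ->
  (forall a (U : set (X a)), nbhs (x a) U -> F [set z | U (z a)]) -> F --> x.
Proof.
move=> FF Fx; apply/cvg_sup => a W [_ [[U oU <-] Ux] sUW].
by apply: filterS sUW _; apply: Fx; exact: open_nbhs_nbhs.
Qed.

(** The sets containing such a box form a filter; the claim is exactly that this filter converges to
    [x], which need only be checked on cylinders. *)
Lemma nbhs_prod_box x (U : set (prod_topology X)) : nbhs x U ->
  exists (F : set A) (V : forall a, set (X a)),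
    [/\ finite_set F, forall a, nbhs (x a) (V a) &
        [set z | forall a, F a -> V a (z a)] `<=` U].
Proof.
pose box : set_system (prod_topology X) := [set W |
  exists (F : set A) (V : forall a, set (X a)),
    [/\ finite_set F, forall a, nbhs (x a) (V a) &
        [set z | forall a, F a -> V a (z a)] `<=` W]].
have box_filter : Filter box.
  split.
  - by exists set0, (fun=> setT); split => // a; exact: filterT.
  - move=> P Q [F [V [Ffin Vx VP]]] [G [W [Gfin Wx WQ]]].
    exists (F `|` G), (fun a => V a `&` W a); split.
    + by rewrite finite_setU.
    + by move=> a; exact: filterI.
    + move=> z FGz; split; [apply: VP => a Fa|apply: WQ => a Ga].
        by have [] := FGz a (or_introl Fa).
      by have [] := FGz a (or_intror Ga).
  - move=> P Q PQ [F [V [Ffin Vx VP]]]; exists F, V; split => //.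
    exact: subset_trans PQ.
apply: (cvg_prod_topology (F := box)) => a W Wx.
(* The box has side [W] at [a] and the whole space elsewhere; as the type of the side depends on
   [b], [W] is transported along [a = b]. *)
have aP b : exists V : set (X b), nbhs (x b) V /\
    forall e : a = b, V = ecast b (set (X b)) e W.
  have [e|ab] := pselect (a = b); last by exists setT; split=> //; exact: filterT.
  by subst b; exists W; split=> // e; rewrite (Prop_irrelevance e erefl).
pose V b := projT1 (cid (aP b)).
exists [set a], V; split=> [||z /(_ a erefl)].
- exact: finite_set1.
- by move=> b; rewrite /V; case: cid => ? [].
- by rewrite /V; case: cid => V' [/= _ /(_ erefl) ->].
Qed.

Definition sigma_prod y : set (prod_topology X) :=
  [set x | countable [set a | x a <> y a]].

Definition finite_support_prod y (E : forall a, set (X a)) :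
    set (prod_topology X) :=
  [set x | finite_set [set a | x a <> y a] /\ forall a, E a (x a)].

Lemma dense_finite_support_prod y (D E : forall a, set (X a)) :
  (forall a, dense (D a)) -> (forall a, D a `<=` E a) -> (forall a, E a (y a)) ->
  dense (finite_support_prod y E).
Proof.
move=> Ddense DE Ey U [x Ux] oU.
have [F [V [Ffin Vx VU]]] := nbhs_prod_box (open_nbhs_nbhs (conj oU Ux)).
have zP a : exists z : X a, [/\ E a z, F a -> V a z & ~ F a -> z = y a].
  have [Fa|nFa] := pselect (F a); last by exists (y a).
  (* Density is tested on open sets, hence the interior of the neighbourhood [V a]. *)
  have [||z [Vz Dz]] := Ddense a (V a)^°.
  - by exists (x a); exact: Vx.
  - exact: open_interior.
  - by exists z; split => // [|_]; [exact: DE | exact: interior_subset].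
pose z a := projT1 (cid (zP a)).
have z_spec a : [/\ E a (z a), F a -> V a (z a) & ~ F a -> z a = y a].
  by rewrite /z; case: cid.
exists z; split; first by apply: VU => a Fa; have [_ + _] := z_spec a; exact.
split=> [|a]; last by have [] := z_spec a.
apply: sub_finite_set Ffin => a /= zya; apply: contrapT => nFa.
by apply: zya; have [_ _] := z_spec a; exact.
Qed.

Lemma subseq_cvg_finite_support_prod y (E : forall a, set (X a)) :
  (forall a, subseq_cvg (E a)) ->
  forall u : nat -> prod_topology X, (forall n, finite_support_prod y E (u n)) ->
  exists2 f : nat -> nat, increasing_seq f &
    exists2 l, sigma_prod y l & u \o f @ \oo --> l.
Proof.
move=> Ecvg u uE.
pose B := \bigcup_n [set a | u n a <> y a].
have Bcount : countable B.
  apply: bigcup_countable => // n _; apply: finite_set_countable.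
  by have [] := uE n.
have uy n a : ~ B a -> u n a = y a.
  by move=> nBa; apply: contrapT => uya; apply: nBa; exists n.
have /countable_injP[num num_inj] := Bcount.
(* Requirement [k] concerns the coordinate of [B] numbered [k], and is vacuous if there is none. *)
pose Q k (f : nat -> nat) := forall a, B a -> num a = k ->
  exists l : X a, (fun n => u (f n) a) @ \oo --> l.
have [||f f_incr Qf] := @diagonal_subsequence Q.
- move=> k f _; have [[a [Ba ak]]|nB] := pselect (exists a, B a /\ num a = k).
    have [|g g_incr ug] := Ecvg a (fun n => u (f n) a).
      by move=> n; have [_] := uE (f n); exact.
    exists g => // b Bb bk.
    have {Bb bk} -> : b = a by apply: num_inj; rewrite ?inE // bk.
    exact: ug.
  by exists id => // a Ba ak; exfalso; apply: nB; exists a.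
- move=> k f f' N Qf ff' a Ba ak; have [l ul] := Qf a Ba ak.
  exists l => W /ul[M _ MW]; exists (maxn N M) => // n /=.
  rewrite geq_max => /andP[Nn Mn]; have [i ni ->] := ff' n Nn.
  by apply: MW => /=; exact: leq_trans ni.
exists f => //.
(* Limits may fail to be unique, so off [B] the value [y a] is imposed to keep the limit in the
   Sigma-product. *)
have lP a : exists l : X a, (~ B a -> l = y a) /\ (fun n => u (f n) a) @ \oo --> l.
  have [Ba|nBa] := pselect (B a); first by have [l] := Qf _ a Ba erefl; exists l.
  exists (y a); split=> // W /nbhs_singleton Wy.
  by exists 0 => // n _ /=; rewrite uy.
pose l a := projT1 (cid (lP a)).
have l_spec a : (~ B a -> l a = y a) /\ (fun n => u (f n) a) @ \oo --> l a.
  by rewrite /l; case: cid.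
exists l; last first.
  by apply: cvg_prod_topology => a; have [_] := l_spec a; exact.
apply: sub_countable Bcount; apply: subset_card_le => a /= lya.
by apply: contrapT => nBa; apply: lya; have [+ _] := l_spec a; exact.
Qed.

Lemma dense_subseq_cvg_sigma_prod y :
  (forall a, sequentially_pracompact (X a)) ->
  exists D : set (prod_topology X), [/\ dense D, D `<=` sigma_prod y &
    forall u : nat -> prod_topology X, (forall n, D (u n)) ->
      exists2 f : nat -> nat, increasing_seq f &
        exists2 l, sigma_prod y l & u \o f @ \oo --> l].
Proof.
move=> hX; pose D a := projT1 (cid2 (hX a)).
have Ddense a : dense (D a) by rewrite /D; case: cid2.
have Dcvg a : subseq_cvg (D a) by rewrite /D; case: cid2.
exists (finite_support_prod y (fun a => D a `|` [set y a])); split.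
- apply: (dense_finite_support_prod Ddense) => a; last by right.
  exact: subsetUl.
- by move=> x [xfin _]; exact: finite_set_countable.
- by apply: subseq_cvg_finite_support_prod => a; exact: subseq_cvgU1.
Qed.

End product.

(** Open sets of [Y] are traces of open sets of [T], so both density and convergence to a point of
    [Y] pass to the subspace. *)
Lemma sequentially_pracompact_set_type (T : topologicalType) (Y D : set T) :
  dense D -> D `<=` Y ->
  (forall u : nat -> T, (forall n, D (u n)) ->
    exists2 f : nat -> nat, increasing_seq f &
      exists2 l, Y l & u \o f @ \oo --> l) ->
  sequentially_pracompact (set_type Y).
Proof.
move=> Ddense DY Dcvg; exists (set_val @^-1` D).
  move=> O [x Ox] [U oU UO]; rewrite -UO in Ox *.
  have [|z [Uz Dz]] := Ddense U _ oU; first by exists (set_val x).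
  by exists (SigSub (mem_set (DY _ Dz))); split.
move=> u Du; have [f f_incr [l Yl ul]] := Dcvg (set_val \o u) Du.
exists f => //; exists (SigSub (mem_set Yl)) => W [_ [[U oU <-] Ul] UW].
apply: filterS UW _; apply: ul; exact: open_nbhs_nbhs.
Qed.

(* A set Y coerced to a type carries the subspace topology, i.e. the initial
   topology of the inclusion. *)
Theorem proposition2p1 (A : Type) (X : A -> topologicalType)
    (hX : forall a : A, sequentially_pracompact (X a)) :
  sequentially_pracompact (prod_topology X) /\
  (forall Y : set (prod_topology X),
     is_sigma_product Y -> sequentially_pracompact (set_type Y)).
Proof.
split=> [|Y [y ->]]; last first.
  have [D [Ddense Dy Dcvg]] := dense_subseq_cvg_sigma_prod y hX.
  exact: sequentially_pracompact_set_type Ddense Dy Dcvg.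
(* The construction needs a base point [y]; in an empty product everything holds vacuously. *)
have [[y]|X0] := pselect (inhabited (prod_topology X)).
  have [D [Ddense _ Dcvg]] := dense_subseq_cvg_sigma_prod y hX.
  exists D => // u /Dcvg[f f_incr [l _ ul]].
  by exists f => //; exists l.
exists setT => [O [x _]|u _]; exfalso; apply: X0; constructor; [exact: x|].
exact: u 0%N.
Qed.
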